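(* Let $O=(a,b)\times(c,d)\subset\mathbb{R}^2$ be a bounded open rectangle, let $h\in L^1(\bar O,\mathbb{R})$ and let $$f(x,y)=\int_a^x \mathrm{d}u\int_c^y h(u,v)\,\mathrm{d}v .$$ Then there are measurable sets $e_1\subset(a,b)$ and $e_2\subset(c,d)$ with $|e_1|=b-a$, $|e_2|=d-c$, such that: (a1) For every $x\in e_1$ and every $y\in(c,d)$, the partial derivative $\partial_1 f(x,y)$ exists and $$\partial_1 f(x,y)=\int_c^y h(x,v)\,\mathrm{d}v.$$ (a2) For every $y\in e_2$ and every $x\in(a,b)$, the partial derivative $\partial_2 f(x,y)$ exists and $$\partial_2 f(x,y)=\int_a^x h(u,y)\,\mathrm{d}u.$$ (b) There exists a measurable set $E\subset e_1\times e_2$ with $|E|=(b-a)(d-c)$, such that for every $(x,y)\in E$ the mixed derivatives exist and $$\partial_2\partial_1 f(x,y)=h(x,y)=\partial_1\partial_2 f(x,y).$$ Moreover, for every $x\in e_1$ the slice $\{y\in(c,d):(x,y)\in E\}$ has one-dimensional Lebesgue measure $d-c$, and for every $y\in e_2$ the slice $\{x\in(a,b):(x,y)\in E\}$ has one-dimensional Lebesgue measure $b-a$.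
   Context: $|\cdot|$ denotes Lebesgue measure (one- or two-dimensional according to the set). $h$ is a fixed (everywhere defined) representative, Lebesgue integrable on the closed rectangle $\bar O=[a,b]\times[c,d]$. $\partial_1$ and $\partial_2$ denote partial derivatives with respect to the first and second variable. A derivative is said to exist only if it exists as a finite real number. $\partial_2\partial_1 f(x,y)$ is the derivative at $y$ of the function $\partial_1 f(x,\cdot)$, and $\partial_1\partial_2 f(x,y)$ is the derivative at $x$ of the function $\partial_2 f(\cdot,y)$. *)

(* Defs.v *)
From HB Require Import structures.
From mathcomp Require Import all_boot all_order all_algebra.
From mathcomp Require Import all_classical all_reals all_analysis.

Set Implicit Arguments.
Unset Strict Implicit.
Unset Printing Implicit Defensive.

Import Order.TTheory GRing.Theory Num.Theory.
Import numFieldNormedType.Exports.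

Local Open Scope classical_set_scope.
Local Open Scope ring_scope.

(* [lebesgue_measure] lives on the Borel sets; the measures below are complete,
   so that [measurable], [integrable] and [\int] refer to Lebesgue measurable
   sets and functions. *)
Notation leb1 := completed_lebesgue_measure.

(* The outer extension of the product of the two Borel-Lebesgue measures, on its
   Caratheodory sigma-algebra. *)
Definition leb2 {R : realType} : set _ -> \bar R :=
  @completed_measure_extension _ _ _
    (@lebesgue_measure R \x @lebesgue_measure R)%E.

HB.instance Definition _ (R : realType) := Measure.on (@leb2 R).

Definition leb1_measurable {R : realType} (A : set R) : Prop :=
  ((wlength idfun)^*)%mu.-cara.-measurable A.

Definition leb2_measurable {R : realType} (A : set (R * R)) : Prop :=
  ((@lebesgue_measure R \x @lebesgue_measure R)%E^*)%mu.-cara.-measurable A.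

Section partial_derivatives.
Context {R : realType}.
Implicit Types (f : R * R -> R) (x y l : R).

Definition partial1 f (p : R * R) : R := 'D_1 (fun s : R => f (s, p.2)) p.1.

Definition partial2 f (p : R * R) : R := 'D_1 (fun t : R => f (p.1, t)) p.2.

(* The partial derivative exists, as a finite number, and equals [l]; the total
   functions [partial1] and [partial2] carry no existence information. *)
Definition has_partial1 f x y l : Prop :=
  is_derive x (1 : R) (fun s : R => f (s, y)) l.

Definition has_partial2 f x y l : Prop :=
  is_derive y (1 : R) (fun t : R => f (x, t)) l.

End partial_derivatives.

(* Meaningful only for [a <= p.1] and [c <= p.2]. *)
Definition iterated_integral {R : realType} (a c : R) (h : R * R -> R)
    (p : R * R) : R :=
  \int[leb1]_(u in `[a, p.1]) \int[leb1]_(v in `[c, p.2]) h (u, v).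

(* Main.v *)
Require Import Defs.
From mathcomp Require Import all_boot all_order all_algebra.
From mathcomp Require Import all_classical all_reals all_analysis.
From mathcomp Require Import measurable_realfun lra.

(* Off a null set N, h agrees on the closed rectangle with an integrable Borel
   function g; for almost every x the section of N at x is null, so all iterated
   integrals may be computed with g. Put G(x, y) = int_c^y g(x, v) dv.

   For a fixed y, Lebesgue's differentiation theorem gives
   d/dx int_a^x G(u, y) du = G(x, y) outside a null set depending on y. For x
   outside the countable union of the exceptional sets of the rational y (for g
   and for |g|) this holds for every y: the mixed increments of the double
   integral of g are dominated by those of |g|, and G(x, .) and its analogue
   for |g| are continuous.

   The points where dG/dy = g form a Borel set, as the increments of G in y can
   be restricted to rationals, and almost every vertical section of its
   complement is null. By Fubini the same holds with the variables exchanged.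
   The part K of the open rectangle outside one of the two good sets is thus
   null, and e1, e2 are obtained by also discarding the abscissas and ordinates
   at which K has a section of positive measure. *)

Set Implicit Arguments.
Unset Strict Implicit.
Unset Printing Implicit Defensive.

Import Order.TTheory GRing.Theory Num.Theory.
Import numFieldNormedType.Exports.

Local Open Scope classical_set_scope.
Local Open Scope ring_scope.

(** * Caratheodory measurable sets and functions modulo null measurable sets *)

Section completion.
Context d (T : measurableType d) (R : realType).
Variable mu : {measure set T -> \bar R}.
Local Notation nu := (@completed_measure_extension _ _ _ mu).

(** The outer measure is an infimum over countable measurable covers; [B] is the intersection of
    covers whose measure exceeds it by at most [1/(n+1)]. *)
Lemma measurable_hull (A : set T) : (nu A < +oo)%E ->
  exists2 B, measurable B & A `<=` B /\ mu B = nu A.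
Proof.
move=> Aoo.
have fA : nu A \is a fin_num by rewrite ge0_fin_numE// outer_measure_ge0.
have cov n : exists B, [/\ measurable B, A `<=` B &
    (mu B <= nu A + n.+1%:R^-1%:E)%E].
  have n0 : (0 < n.+1%:R^-1 :> R)%R by rewrite invr_gt0.
  have [_/= [F [mF AF] <-] /ltW ltF] := lb_ereal_inf_adherent n0 fA.
  exists (\bigcup_k F k); split => //; first exact: bigcupT_measurable.
  apply: le_trans ltF; apply: measure_sigma_subadditive => //.
  exact: bigcupT_measurable.
have /choice[B /all_and3[mB AB ltB]] := cov.
have mBB : measurable (\bigcap_n B n) by exact: bigcapT_measurable.
have ABB : A `<=` \bigcap_n B n by exact: sub_bigcap.
exists (\bigcap_n B n) => //; split => //.
apply/eqP; rewrite eq_le; apply/andP; split; last first.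
  by rewrite -measurable_mu_extE//; exact: le_outer_measure.
apply/lee_addgt0Pr => /= _/posnumP[e]; near \oo => n.
apply: (@le_trans _ _ (mu (B n))).
  by apply: le_measure; rewrite ?inE//; exact: bigcap_inf.
rewrite (le_trans (ltB n))// leeD// lee_fin ltW//.
by near: n; apply: near_infty_natSinv_lt.
Unshelve. all: by end_near. Qed.

(** [B] is a hull of [A], and [N] a hull of the rest of [B], which is null by additivity since [A]
    is Caratheodory measurable of finite outer measure. *)
Lemma caratheodory_measurable_mod_null (D A : set T) :
  measurable D -> (mu D < +oo)%E -> A `<=` D -> (mu^*)%mu.-cara.-measurable A ->
  exists B N, [/\ measurable B, measurable N, mu N = 0%E &
    forall x, ~ N x -> (A x <-> B x)].
Proof.
move=> mD Doo AD mA.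
have finS X : X `<=` D -> (nu X < +oo)%E.
  move=> XD; rewrite (le_lt_trans _ Doo)// -measurable_mu_extE//.
  exact: le_outer_measure.
have Aoo := finS _ AD.
have [B0 mB0 [AB0 B0A]] := measurable_hull Aoo.
have mBA : (mu^*)%mu.-cara.-measurable (B0 `\` A).
  by apply: measurableD => //; exact: caratheodory_measurable_mu_ext.
have BA0 : nu (B0 `\` A) = 0%E.
  rewrite measureD//=; last 2 first.
    exact: caratheodory_measurable_mu_ext.
    by rewrite /= /completed_measure_extension measurable_mu_extE// B0A.
  rewrite setIidr// /completed_measure_extension measurable_mu_extE// B0A.
  by rewrite subee// ge0_fin_numE// outer_measure_ge0.
have [|N mN [BAN N0]] := @measurable_hull (B0 `\` A); first by rewrite BA0.
exists B0, N; split => //; first by rewrite N0.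
move=> x Nx; split => [/AB0//|Bx].
by apply: contrapT => Ax; apply: Nx; exact: BAN.
Qed.

(** Each set where [h] exceeds a given rational is measurable up to a null set. [N] is the union of
    these countably many null sets, and [g] is [h] on [D] minus [N] and 0 elsewhere. *)
Lemma caratheodory_measurable_fun_mod_null (D : set T) (h : T -> R) :
  measurable D -> (mu D < +oo)%E ->
  measurable_fun (D : set (caratheodory_type (mu^*)%mu)) h ->
  exists (g : T -> R) N, [/\ measurable_fun setT g, measurable N, mu N = 0%E,
    (forall x, D x -> ~ N x -> g x = h x) & (forall x, ~ D x -> g x = 0)].
Proof.
move=> mD Doo mh.
(* [q] enumerates the rationals; an index that codes no rational is sent to 0. *)
pose q n : R := ratr (odflt 0%Q (unpickle n)).
have q_dense x y : x < y -> exists n, x < q n < y.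
  move=> /rat_in_itvoo[r]; rewrite in_itv/= => rxy; exists (pickle r).
  by rewrite /q pickleK.
have mcD : (mu^*)%mu.-cara.-measurable D by exact: caratheodory_measurable_mu_ext.
have hB n : exists BN : set T * set T, [/\ measurable BN.1, measurable BN.2,
    mu BN.2 = 0%E & forall x, ~ BN.2 x -> ((D x /\ q n < h x) <-> BN.1 x)].
  have [|B [N [mB mN N0 BN]]] := @caratheodory_measurable_mod_null D
      (D `&` [set x | q n < h x]) mD Doo (@subIsetl _ _ _).
    have -> : [set x | q n < h x] = h @^-1` `]q n, +oo[%classic.
      by apply/seteqP; split => x /=; rewrite in_itv/= andbT.
    exact: mh.
  by exists (B, N).
have /choice[BN /all_and4[mB mN N0 BNP]] := hB.
pose N := \bigcup_n (BN n).2.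
have mNN : measurable N by exact: bigcupT_measurable.
have NN0 : mu N = 0%E.
  apply: measure_negligible => //; apply: negligible_bigcup => n.
  by exists (BN n).2; split.
have mE : measurable (D `\` N) by exact: measurableD.
exists (h \_ (D `\` N)), N; split => //.
- apply/(measurable_restrictT _ mE).
  apply: (measurability _ (RGenOInfty.measurableE R)) => // _ [_ [x ->] <-].
  (* Some [q n] lies strictly between [x] and any larger value of [h], so a superlevel set at a real
     [x] is a countable union of superlevel sets at rationals. *)
  rewrite (_ : _ `&` _ =
      \bigcup_n (if x < q n then (BN n).1 `&` (D `\` N) else set0)).
    apply: bigcupT_measurable => n; case: ifP => // _.
    by apply: measurableI.
  apply/seteqP; split => z /=.
    rewrite in_itv/= andbT => -[[Dz Nz]] /q_dense[n /andP[xq qh]].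
    exists n => //; rewrite xq; split => //.
    by apply/BNP => // Nnz; apply: Nz; exists n.
  move=> [n _]; case: ifP => // xq [Bz [Dz Nz]]; split => //.
  rewrite in_itv/= andbT (lt_trans xq)//.
  have Nnz : ~ (BN n).2 z by move=> Nnz; apply: Nz; exists n.
  by have /(BNP n z Nnz)[] := Bz.
- by move=> x Dx Nx; rewrite patchE mem_set.
- by move=> x Dx; rewrite patchE memNset// => -[].
Qed.

End completion.

(** * Transfer of integrals between a complete measure and a measure that it extends *)

Section complete_transfer.
Context d1 d2 (T1 : measurableType d1) (T2 : measurableType d2) (R : realType).
Variables (m1 : {measure set T1 -> \bar R}) (m2 : {measure set T2 -> \bar R}).
(* In the applications [phi] is the identity, from the completed to the Borel
   sigma-algebra. *)
Variables (phi : T1 -> T2).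
Hypotheses (cm1 : measure_is_complete m1) (mphi : measurable_fun setT phi).
Hypothesis m12 : forall A, measurable A -> m2 A = m1 (phi @^-1` A).
Variables (D N : set T2) (g : T2 -> \bar R) (f : T1 -> \bar R).
Hypotheses (mD : measurable D) (mg : measurable_fun setT g).
Hypotheses (mN : measurable N) (N0 : m2 N = 0%E).
Hypothesis fg : forall x, D (phi x) -> ~ N (phi x) -> f x = g (phi x).

Let mphiI A : measurable A -> measurable (phi @^-1` A).
Proof. by move=> mA; rewrite -[X in measurable X]setTI; exact: mphi. Qed.

Let aefg : ae_eq m1 (phi @^-1` D) (g \o phi) f.
Proof.
exists (phi @^-1` N); split; [exact: mphiI|by rewrite -m12|].
by move=> x /= /not_implyP[Dx gf]; apply: contrapT => Nx; apply: gf; rewrite fg.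
Qed.

Let mgphi : measurable_fun (phi @^-1` D) (g \o phi).
Proof. by apply: measurable_funTS; apply: measurableT_comp. Qed.

(** [f] equals the measurable [g \o phi] almost everywhere, which suffices because [m1] is
    complete. *)
Lemma complete_measurable_fun : measurable_fun (phi @^-1` D) f.
Proof. by apply: ae_measurable_fun aefg _. Qed.

Let m2E A : measurable A -> A `<=` D -> m2 A = pushforward m1 phi A.
Proof. by move=> mA _; rewrite m12. Qed.

(** Both sides are compared through the pushforward of [m1], which agrees with [m2] on measurable
    sets. For nonnegative functions this requires no integrability, hence it decides integrability
    in both directions. *)
Lemma complete_integral_abs :
  (\int[m1]_(x in phi @^-1` D) `|f x| = \int[m2]_(y in D) `|g y|)%E.
Proof.
rewrite [RHS](eq_measure_integral (pushforward m1 phi))//.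
rewrite [RHS]ge0_integral_pushforward//; last first.
  by apply: measurable_funTS; exact: measurableT_comp.
apply/esym/ge0_ae_eq_integral => //; first exact: mphiI.
- exact: (@measurableT_comp _ _ _ _ _ _ abse).
- by apply: measurableT_comp => //; exact: complete_measurable_fun.
- by move=> x _; exact: abse_ge0.
- exact: (ae_eq_abse aefg).
Qed.

Lemma complete_integrable :
  m1.-integrable (phi @^-1` D) f <-> m2.-integrable D g.
Proof.
split=> /integrableP[_ fi]; apply/integrableP; split.
- exact: measurable_funTS.
- by rewrite -complete_integral_abs.
- exact: complete_measurable_fun.
- by rewrite complete_integral_abs.
Qed.

Lemma complete_integral :  m2.-integrable D g ->
  (\int[m1]_(x in phi @^-1` D) f x = \int[m2]_(y in D) g y)%E.
Proof.
move=> ig.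
have ig1 : m1.-integrable (phi @^-1` D) (g \o phi).
  apply/integrableP; split => //.
  have /integrableP[_] := complete_integrable.2 ig; apply: le_lt_trans.
  rewrite le_eqVlt; apply/orP; left; apply/eqP.
  apply: ge0_ae_eq_integral => //; first exact: mphiI.
  - exact: measurableT_comp.
  - by apply: measurableT_comp => //; exact: complete_measurable_fun.
  - by apply: filterS aefg => x /= fgx /fgx ->.
rewrite [RHS](eq_measure_integral (pushforward m1 phi))//.
rewrite [RHS]integral_pushforward//.
apply/esym/ae_eq_integral => //; [exact: mphiI|exact: complete_measurable_fun].
Qed.

End complete_transfer.

(** * First-order expansions, and derivatives of families with dominated increments *)

Section derivative_estimates.
Context {R : realType}.

(** Clearing the denominator admits the increment 0 and makes the estimate linear in the values of
    [f]. *)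
Lemma is_derive1_nearP (f : R -> R) (x l : R) :
  is_derive x (1 : R) f l <->
  forall e, 0 < e ->
    \forall h \near (0 : R), `|f (x + h) - f x - h * l| <= e * `|h|.
Proof.
have E h : h != 0 -> `|f (x + h) - f x - h * l| =
    `|h| * `|l - h^-1 *: (f (h *: 1 + x) - f x)|.
  move=> h0; rewrite -normrM distrC mulrBr; congr `| _ |.
  by rewrite /GRing.scale/= mulr1 mulrA divff// mul1r [x + h]addrC.
split=> [[df dl] e e0|H].
- have /cvgrPdist_le/(_ _ e0) := df.
  rewrite -/(derive f x 1) dl near_withinE; apply: filterS => h He.
  have [->|h0] := eqVneq h 0; first by rewrite addr0 subrr mul0r subrr normr0 mulr0.
  by rewrite E// mulrC ler_wpM2r//; exact: He.
- have cl : (fun h => h^-1 *: ((f \o shift x) (h *: 1) - f x)) @ 0^' --> l.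
    apply/cvgrPdist_le => e e0; rewrite near_withinE.
    move: (H e e0); apply: filterS => h /[swap] h0.
    by rewrite E// mulrC ler_pM2r// normr_gt0.
  split; first by apply/cvg_ex; exists l.
  by apply/cvg_lim => //; exact: Rhausdorff.
Qed.

(* [A] controls the mixed increments of [P], so that differentiability of both at
   a dense set of parameters [t] passes to all [t]. *)
Lemma is_derive_dominated (P A : R -> R -> R) (L M : R -> R) (a c x y : R) :
  a < x -> c < y ->
  (forall s s' t t', a <= s -> s <= s' -> c <= t -> t <= t' ->
    `|(P s' t' - P s t') - (P s' t - P s t)| <=
      (A s' t' - A s t') - (A s' t - A s t)) ->
  {for y, continuous L} -> {for y, continuous M} ->
  (forall q : rat, is_derive x (1 : R) (P^~ (ratr q)) (L (ratr q))) ->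
  (forall q : rat, is_derive x (1 : R) (A^~ (ratr q)) (M (ratr q))) ->
  is_derive x (1 : R) (P^~ y) (L y).
Proof.
move=> ax cy PA cL cM dP dA; apply/is_derive1_nearP => e0 e0_gt0.
(* Six errors of size [e * |h|] add up: three from the expansions at [q] and [q'], three from
   replacing [L] and [M] there by their values at [y]. *)
pose e := e0 / 6; have e_gt0 : 0 < e by rewrite divr_gt0.
have close : \forall t \near y, `|L y - L t| <= e /\ `|M y - M t| <= e.
  by near=> t; split; near: t; move: e e_gt0; exact/cvgrPdist_le.
have [d /= d0 dclose] := (nbhs_ballP _ _).1 close.
have [q /[!in_itv]/=/andP[q1 q2]] :
    exists q : rat, ratr q \in `]Num.max c (y - d), y[.
  by apply: rat_in_itvoo; rewrite gt_max cy ltrBlDr ltrDl.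
have [q' /[!in_itv]/=/andP[q1' q2']] : exists q : rat, ratr q \in `]y, (y + d)[.
  by apply: rat_in_itvoo; rewrite ltrDl.
move: q1; rewrite gt_max => /andP[cq dq].
have [Lq Mq] : `|L y - L (ratr q)| <= e /\ `|M y - M (ratr q)| <= e.
  by apply: dclose; rewrite /ball/= gtr0_norm ?subr_gt0// ltrBlDr -ltrBlDl.
have [_ Mq'] : `|L y - L (ratr q')| <= e /\ `|M y - M (ratr q')| <= e.
  by apply: dclose; rewrite /ball/= ltr0_norm ?subr_lt0// opprB ltrBlDl.
move: (ratr q) (ratr q') (dP q) (dA q) (dA q') cq q2 q1' Lq Mq Mq' {q2' dq}.
move=> {}q {}q' /is_derive1_nearP/(_ _ e_gt0) Pq.
move=> /is_derive1_nearP/(_ _ e_gt0) Aq.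
move=> /is_derive1_nearP/(_ _ e_gt0) Aq' cq qy yq' Lq Mq Mq'.
near=> h.
have Pqh : `|P (x + h) q - P x q - h * L q| <= e * `|h| by near: h.
have Aqh : `|A (x + h) q - A x q - h * M q| <= e * `|h| by near: h.
have Aqh' : `|A (x + h) q' - A x q' - h * M q'| <= e * `|h| by near: h.
have axh : a <= x + h.
  near: h; exists (x - a); first by rewrite /= subr_gt0.
  by move=> h /=; rewrite sub0r normrN ltr_norml => /andP[+ _]; lra.
have hL : `|h * L y - h * L q| <= e * `|h|.
  by rewrite -mulrBr normrM mulrC ler_wpM2r.
have hM : `|h * M y - h * M q| <= e * `|h|.
  by rewrite -mulrBr normrM mulrC ler_wpM2r.
have hM' : `|h * M y - h * M q'| <= e * `|h|.
  by rewrite -mulrBr normrM mulrC ler_wpM2r.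
have -> : e0 * `|h| = 6 * (e * `|h|) by rewrite /e; lra.
move: (e * `|h|) (h * L y) (h * L q) (h * M y) (h * M q) (h * M q')
  Pqh Aqh Aqh' hL hM hM'.
move=> k ly lq my mq mq'.
have cy' := ltW cy; have cq' := ltW cq; have ax' := ltW ax.
have qy' := ltW qy; have yq'' := ltW yq'.
rewrite !ler_norml => /andP[? ?] /andP[? ?] /andP[? ?] /andP[? ?] /andP[? ?].
move=> /andP[? ?].
(* The mixed increment of [P] between [q] and [y] is bounded by that of [A]. Mixed increments of [A]
   are nonnegative, so the bound only grows when [y] is replaced by [q'], and at [q] and [q'] the
   first-order expansion of [A] is known. *)
have [xh|/ltW xh] := leP x (x + h).
- have := PA _ _ _ _ ax' xh cq' qy'; have := PA _ _ _ _ ax' xh cy' yq''.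
  by rewrite !ler_norml => /andP[? ?] /andP[? ?]; lra.
- have := PA _ _ _ _ axh xh cq' qy'; have := PA _ _ _ _ axh xh cy' yq''.
  by rewrite !ler_norml => /andP[? ?] /andP[? ?]; lra.
Unshelve. all: by end_near. Qed.

End derivative_estimates.

(** * Primitives in one variable *)

Section primitives.
Context {R : realType}.
Notation mu := (@lebesgue_measure R).
Implicit Types (f : R -> R) (a x : R).

Lemma primitive_continuous f a x : mu.-integrable setT (EFin \o f) -> a < x ->
  {for x, continuous (fun s => \int[mu]_(t in `[a, s]) f t)}.
Proof.
(* The right end [x + 1] makes [x] an interior point. *)
move=> fi ax; have ax1 : a < x + 1 by rewrite ltr_wpDr.
have fi1 : mu.-integrable `[a, x + 1] (EFin \o f).
  by apply: integrableS fi.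
have := parameterized_integral_continuous (ltW ax1) fi1.
move=> /continuous_within_itvP => /(_ ax1)[+ _ _]; apply.
by rewrite in_itv/= ax/= ltrDl.
Qed.

(* The cast [: R] under [is_derive] fixes the normed module instance of the
   codomain; without it another, merely convertible, instance is inferred. *)
Lemma ae_is_derive_primitive f a : mu.-integrable setT (EFin \o f) ->
  {ae mu, forall x : R, a < x ->
    is_derive x (1 : R) (fun s : R => \int[mu]_(t in `[a, s]) f t : R)
      (f x)}.
Proof.
move=> fi.
have lf : locally_integrable setT f.
  by have := integrable_locally measurableT fi; rewrite patch_setT.
have fiy y : mu.-integrable `[a, y] (EFin \o f) by apply: integrableS fi.
have := FTC1 fiy lf; apply: filterS; first exact: (ae_filter_ringOfSetsType mu).
move=> x H ax.
by have [dF <-] := H ax; rewrite derive1E; exact: derivableP.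
Qed.

Lemma Rintegral_itv_incr f a x y : mu.-integrable setT (EFin \o f) ->
  a <= x -> x <= y ->
  \int[mu]_(t in `[a, y]) f t - \int[mu]_(t in `[a, x]) f t =
  \int[mu]_(t in `]x, y]) f t.
Proof.
move=> fi ax xy; rewrite Rintegral_itvB ?bnd_simp//.
by apply: integrableS fi.
Qed.

End primitives.

(** * Measurability and integrability of the primitive in the second variable *)

Section partial_integral.
Context {R : realType}.
Notation mu := (@lebesgue_measure R).
Implicit Types (g : R * R -> R) (c x y : R).

(* Junk value [0] where the slice [g (p.1, _)] has an infinite integral. *)
Definition partial_integral c g (p : R * R) : R :=
  \int[mu]_(v in `[c, p.2]) g (p.1, v).

Lemma measurable_partial_integral c g : measurable_fun setT g ->
  measurable_fun setT (partial_integral c g).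
Proof.
move=> mg.
(* The variable upper limit becomes a condition in the integrand, so that Tonelli applies to the
   positive and negative parts of [k], whether or not their integrals are finite. *)
pose k (q : (R * R) * R) : \bar R :=
  if (c <= q.2) && (q.2 <= q.1.2) then (g (q.1.1, q.2))%:E else 0%E.
have mk : measurable_fun setT k.
  apply: measurable_fun_ifT => //.
    apply: measurable_and; apply: measurable_fun_ler => //.
    exact: measurableT_comp.
  apply/measurable_EFinP; apply: measurableT_comp => //.
  apply: measurable_fun_pair => //.
  exact: (measurableT_comp measurable_fst measurable_fst).
have -> : partial_integral c g = fine \o (fun p =>
    (\int[mu]_v k^\+ (p, v) - \int[mu]_v k^\- (p, v))%E).
  apply/funext => p /=; congr fine; rewrite integral_mkcond integralE.
  congr (_ - _)%E; apply: eq_integral => v _;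
    rewrite ?(funeposE,funenegE) patchE /k/=; congr (maxe _ _);
    by rewrite -[_ \in _]/(v \in [set` `[c, p.2]]) mem_setE in_itv.
apply: measurableT_comp; first exact: fine_measurable.
apply: emeasurable_funB.
- by apply: measurable_fun_fubini_tonelli_F => //; exact: measurable_funepos.
- by apply: measurable_fun_fubini_tonelli_F => //; exact: measurable_funeneg.
Qed.

Variables (g : R * R -> R) (mg : measurable_fun setT g).
Hypothesis ig : (mu \x mu)%E.-integrable setT (EFin \o g).

(** The function is dominated by the integral of [|g (x, v)|] over all [v], which is integrable in
    [x] by Tonelli. Where the slice integral is infinite, the default value 0 respects the bound. *)
Lemma integrable_partial_integral c y :
  mu.-integrable setT (EFin \o (fun x => partial_integral c g (x, y))).
Proof.
have mP : measurable_fun setT (fun x => partial_integral c g (x, y)).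
  by apply: measurableT_comp (measurable_partial_integral c mg) _.
apply/integrableP; split; first exact/measurable_EFinP.
have mEg : measurable_fun setT (EFin \o g) by exact/measurable_EFinP.
have := (integrable12ltyP mu mu mEg).1 ig; apply: le_lt_trans.
have mx x : measurable_fun setT (fun v => (g (x, v))%:E).
  by apply/measurable_EFinP; exact: measurableT_comp.
apply: ge0_le_integral => //.
- by do 2 apply: measurableT_comp => //.
- apply: (@measurable_fun_fubini_tonelli_F _ _ (measurableTypeR R)
    (measurableTypeR R) R mu (abse \o (EFin \o g))) => [|x]; last exact: abse_ge0.
  exact: (measurableT_comp (@abse_measurable _ _) mEg).
move=> x _; rewrite /partial_integral /=.
apply: (@le_trans _ _ `|\int[mu]_(v in `[c, y]) (g (x, v))%:E|%E).
  rewrite /Rintegral; case: (\int[mu]_(v in _) _)%E => //=.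
  - by rewrite normr0 leey.
  - by rewrite normr0 leey.
apply: (@le_trans _ _ (\int[mu]_(v in `[c, y]) `|(g (x, v))%:E|)%E).
  by apply: le_abse_integral => //; exact: measurable_funTS (mx x).
by apply: ge0_subset_integral => //; exact: measurableT_comp (mx x).
Qed.

Lemma ae_integrable_slice :
  {ae mu, forall x, mu.-integrable setT (fun v => (g (x, v))%:E)}.
Proof. exact: (@ae_integrable1 _ _ _ _ R mu mu (EFin \o g)). Qed.

End partial_integral.

Lemma ae_le_Rintegral d (T : measurableType d) (R : realType)
    (m : {measure set T -> \bar R}) (D : set T) (f1 f2 : T -> R) :
  measurable D -> m.-integrable D (EFin \o f1) -> m.-integrable D (EFin \o f2) ->
  {ae m, forall x, D x -> f1 x <= f2 x} ->
  \int[m]_(x in D) f1 x <= \int[m]_(x in D) f2 x.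
Proof.
move=> mD if1 if2 f12; rewrite -subr_ge0 -RintegralB//.
have if21 : m.-integrable D (EFin \o (fun x => f2 x - f1 x)).
  exact: (integrableB mD if2 if1).
have mf21 := measurable_int _ if21.
(* The difference is nonnegative only almost everywhere; its absolute value is so everywhere and has
   the same integral. *)
rewrite [leRHS](_ : _ = \int[m]_(x in D) `|f2 x - f1 x|).
  by apply: Rintegral_ge0.
congr fine; apply: ae_eq_integral => //.
  exact: (measurableT_comp (@abse_measurable _ _) mf21).
apply: filterS f12 => x f12 Dx /=.
by rewrite ger0_norm// subr_ge0 f12.
Qed.

#[local] Instance ae_lebesgue_filter (R : realType) :
  Filter (nbhs (almost_everywhere (@lebesgue_measure R))).
Proof. exact: (ae_filter_ringOfSetsType (@lebesgue_measure R)). Qed.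

(** * Differentiability in the first variable, for all values of the second at once *)

Section iterated_partial_integral.
Context {R : realType}.
Notation mu := (@lebesgue_measure R).
Implicit Types (g : R * R -> R) (a c x y : R).

Let P a c g s t : R := \int[mu]_(u in `[a, s]) partial_integral c g (u, t).

(** A mixed increment is the integral of [g] over a rectangle, because primitives are additive in
    their upper limit; the triangle inequality is applied to the outer integral and then, for almost
    every [u], to the inner one. *)
Lemma iterated_partial_integral_dominated g a c s s' t t' :
  measurable_fun setT g -> (mu \x mu)%E.-integrable setT (EFin \o g) ->
  a <= s -> s <= s' -> c <= t -> t <= t' ->
  `|(P a c g s' t' - P a c g s t') - (P a c g s' t - P a c g s t)| <=
  (P a c (Num.norm \o g) s' t' - P a c (Num.norm \o g) s t')
  - (P a c (Num.norm \o g) s' t - P a c (Num.norm \o g) s t).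
Proof.
move=> mg ig as_ ss' ct tt'.
have mg' : measurable_fun setT (Num.norm \o g) by exact: measurableT_comp.
have ig' : (mu \x mu)%E.-integrable setT (EFin \o (Num.norm \o g)).
  exact: (integrable_norm ig).
have iP h y (mh : measurable_fun setT h)
    (ih : (mu \x mu)%E.-integrable setT (EFin \o h)) :
    mu.-integrable `]s, s'] (EFin \o fun x => partial_integral c h (x, y)).
  by apply: integrableS (integrable_partial_integral mh ih c y).
have PE h (mh : measurable_fun setT h)
    (ih : (mu \x mu)%E.-integrable setT (EFin \o h)) :
    P a c h s' t' - P a c h s t' - (P a c h s' t - P a c h s t) =
    \int[mu]_(u in `]s, s'])
      (partial_integral c h (u, t') - partial_integral c h (u, t)).
  have E y := Rintegral_itv_incr (integrable_partial_integral mh ih c y) as_ ss'.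
  rewrite (RintegralB _ (iP h t' mh ih) (iP h t mh ih))//.
  by congr (_ - _); exact: E.
have iB h (mh : measurable_fun setT h)
    (ih : (mu \x mu)%E.-integrable setT (EFin \o h)) :
    mu.-integrable `]s, s']
     (EFin \o fun u => partial_integral c h (u, t') - partial_integral c h (u, t)).
  apply: (@integrableB _ _ _ mu _ _
    (EFin \o (fun u => partial_integral c h (u, t')))
    (EFin \o (fun u => partial_integral c h (u, t)))) => //; exact: iP.
rewrite !PE//; apply: le_trans (le_normr_Rintegral _ _) _ => //; first exact: iB.
apply: ae_le_Rintegral => //; [exact: (integrable_norm (iB _ mg ig))|exact: iB|].
have := ae_integrable_slice ig; apply: filterS => u iu _.
have iu' : mu.-integrable setT (EFin \o (fun v => `|g (u, v)|)).
  exact: (integrable_norm iu).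
rewrite /partial_integral/= !Rintegral_itv_incr//.
by apply: le_normr_Rintegral => //; apply: integrableS iu.
Qed.

Lemma ae_is_derive_iterated_integral g a c :
  measurable_fun setT g -> (mu \x mu)%E.-integrable setT (EFin \o g) ->
  {ae mu, forall x : R, a < x -> forall y, c < y ->
    is_derive x (1 : R)
      (fun s : R => \int[mu]_(u in `[a, s]) partial_integral c g (u, y) : R)
      (partial_integral c g (x, y))}.
Proof.
move=> mg ig.
have mg' : measurable_fun setT (Num.norm \o g) by exact: measurableT_comp.
have ig' : (mu \x mu)%E.-integrable setT (EFin \o (Num.norm \o g)).
  exact: (integrable_norm ig).
have aeq h (mh : measurable_fun setT h)
    (ih : (mu \x mu)%E.-integrable setT (EFin \o h)) :
    {ae mu, forall x : R, a < x -> forall q : rat,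
    is_derive x (1 : R) (P a c h ^~ (ratr q)) (partial_integral c h (x, ratr q))}.
  (* Rationals are replaced by their codes, so that the exceptional sets form a sequence. *)
  have : {ae mu, forall (x : R) (n : nat), a < x ->
    forall q : rat, unpickle n = Some q ->
    is_derive x (1 : R) (P a c h ^~ (ratr q)) (partial_integral c h (x, ratr q))}.
    apply: ae_foralln => n; case: (unpickle n) => [q|]; last exact: aeW.
    have := ae_is_derive_primitive a (integrable_partial_integral mh ih c (ratr q)).
    by apply: filterS => x H ax _ [<-]; exact: H.
  by apply: filterS => x H ax q; apply: (H (pickle q)) => //; rewrite pickleK.
have : {ae mu, forall x : R, mu.-integrable setT (fun v => (g (x, v))%:E)}.
  exact: ae_integrable_slice.
move: (aeq _ mg ig) (aeq _ mg' ig'); apply: filterS3 => x dg dg' ix ax y cy.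
have ix' : mu.-integrable setT (EFin \o (fun v => `|g (x, v)|)).
  exact: (integrable_norm ix).
exact: (@is_derive_dominated _ (P a c g) (P a c (Num.norm \o g))
  (fun t => partial_integral c g (x, t))
  (fun t => partial_integral c (Num.norm \o g) (x, t)) a c x y ax cy
  (fun s s' t t' => iterated_partial_integral_dominated mg ig)
  (primitive_continuous ix cy) (primitive_continuous ix' cy) (dg ax) (dg' ax)).
Qed.

End iterated_partial_integral.

(** * Measurability of a set of differentiability *)

Section lebesgue_points.
Context {R : realType}.
Notation mu := (@lebesgue_measure R).
Implicit Types (g : R * R -> R) (a c x y : R).

(** [W] demands that for each [j] some [k] bounds the error by [|q|/(j+1)] for all rational
    increments [q] with [|q| < 1/(k+1)]. This is measurable without any continuity, which is only
    required of the section [G (x, _)] at which [W] is read as differentiability. *)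
Lemma measurable_is_derive_set (G g : R * R -> R) :
  measurable_fun setT G -> measurable_fun setT g ->
  exists W : set (R * R), measurable W /\
    forall x c, (forall y, c < y -> {for y, continuous (fun t => G (x, t))}) ->
      forall y, c < y ->
      (W (x, y) <-> is_derive y (1 : R) (fun t => G (x, t)) (g (x, y))).
Proof.
move=> mG mg.
pose V (j k n : nat) : set (R * R) :=
  [set p | forall q : rat, unpickle n = Some q -> `|ratr q| < k.+1%:R^-1 :> R ->
    `|G (p.1, p.2 + ratr q) - G p - ratr q * g p| <= j.+1%:R^-1 * `|ratr q : R| ].
have mV j k n : measurable (V j k n).
  rewrite /V; case: (unpickle n) => [q|]; last first.
    by rewrite (_ : [set _ | _] = setT)//; apply/seteqP; split.
  have [qk|qk] := ltP `|ratr q : R| k.+1%:R^-1; last first.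
    rewrite (_ : [set _ | _] = setT)//; apply/seteqP; split => // p _ q' [<-].
    by rewrite ltNge qk.
  pose F p := `|G (p.1, p.2 + ratr q) - G p - ratr q * g p|.
  rewrite (_ : [set _ | _] =
      setT `&` F @^-1` `]-oo, (j.+1%:R^-1 * `|ratr q : R|)]%classic).
    suff : measurable_fun setT F by apply.
    apply: measurableT_comp => //; apply: measurable_funB; last first.
      by apply: measurable_funM => //.
    apply: measurable_funB => //; apply: measurableT_comp => //.
    apply: measurable_fun_pair => //; apply: measurable_funD => //.
  apply/seteqP; split => p /=; rewrite in_itv/=.
    by move=> H; split => //; exact: H.
  by move=> [_ H] q' [<-].
exists (\bigcap_j \bigcup_k \bigcap_n V j k n); split.
  by apply: bigcapT_measurable => j; apply: bigcupT_measurable => k;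
     exact: bigcapT_measurable.
move=> x c cG y cy; split => [W|/is_derive1_nearP H j _].
- apply/is_derive1_nearP => e e0.
  have [j je] : exists j : nat, j.+1%:R^-1 < e.
    have [j _ /(_ j (leqnn j))] := near_infty_natSinv_lt (PosNum e0).
    by exists j.
  have [k _ Vk] := W j I.
  near=> h; apply: le_trans (_ : j.+1%:R^-1 * `|h| <= _); last first.
    by rewrite ler_wpM2r// ltW.
  have hk : `|h| < k.+1%:R^-1.
    near: h; exists k.+1%:R^-1; first by rewrite /= invr_gt0.
    by move=> h /=; rewrite sub0r normrN.
  have ch : c < y + h.
    near: h; exists (y - c); first by rewrite /= subr_gt0.
    by move=> h /=; rewrite sub0r normrN ltr_norml => /andP[+ _]; lra.
  (* If the bound fails at a real increment [h], the excess [D] is positive there, hence by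
     continuity also at a nearby rational increment, against [Vk]. *)
  rewrite leNgt; apply/negP => hlt.
  pose D (t : R) := `|G (x, y + t) - G (x, y) - t * g (x, y)| - j.+1%:R^-1 * `|t|.
  have cD : {for h, continuous D}.
    have cGh : G (x, y + t) @[t --> h] --> G (x, y + h).
      apply: (@cvg_comp _ _ _ (fun t => y + t) (fun s => G (x, s)) _
        (nbhs (y + h))).
        by apply: cvgD; [exact: cvg_cst|exact: cvg_id].
      exact: cG.
    apply: cvgB.
      apply: cvg_norm; apply: cvgB; last by apply: cvgMl; exact: cvg_id.
      by apply: cvgB => //; exact: cvg_cst.
    by apply: cvgMr; apply: cvg_norm; exact: cvg_id.
  have D0 : 0 < D h by rewrite subr_gt0.
  have : \forall t \near h, 0 < D t /\ `|t| < k.+1%:R^-1.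
    near=> t; split; near: t.
      by move/cvgr_gt : cD; apply.
    by apply: (cvgr_lt (`|h|)) => //; apply: cvg_norm; exact: cvg_id.
  move=> /nbhs_ballP[r /= r0 rD].
  have [q /[!in_itv]/=/andP[hq qr]] : exists q : rat, ratr q \in `]h, (h + r)[.
    by apply: rat_in_itvoo; rewrite ltrDl.
  have [|Dq qk] := rD (ratr q).
    by rewrite /ball/= distrC gtr0_norm ?subr_gt0// ltrBlDl.
  have := Vk (pickle q) I q; rewrite pickleK => /(_ erefl qk)/=.
  by move: Dq; rewrite subr_gt0 => /lt_geF ->.
- have j0 : 0 < j.+1%:R^-1 :> R by rewrite invr_gt0.
  have [r /= r0 rH] := (nbhs_ballP _ _).1 (H _ j0).
  have [k kr] : exists k : nat, k.+1%:R^-1 < r.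
    have [k _ /(_ k (leqnn k))] := near_infty_natSinv_lt (PosNum r0).
    by exists k.
  exists k => // n _ q _ qk /=; apply: rH.
  by rewrite /ball/= sub0r normrN (lt_trans qk).
Unshelve. all: by end_near. Qed.

End lebesgue_points.

(** * The mixed derivative almost everywhere, and the exchange of the two integrations *)

Section mixed_derivative.
Context {R : realType}.
Notation mu := (@lebesgue_measure R).
Local Notation swap := (fun p : R * R => (p.2, p.1)).
Implicit Types (g : R * R -> R) (a c x y : R).

(** A single null set [Z] of abscissas serves all conclusions. Off it [g (x, _)] is integrable, so
    its primitive is continuous, and Lebesgue differentiation in [y] gives the last one. *)
Lemma ae_mixed_derivative g a c :
  measurable_fun setT g -> (mu \x mu)%E.-integrable setT (EFin \o g) ->
  exists (W : set (R * R)) (Z : set R),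
    [/\ measurable W, measurable Z, mu Z = 0%E & forall x, ~ Z x ->
    [/\ mu.-integrable setT (fun v => (g (x, v))%:E),
        a < x -> forall y, c < y ->
          is_derive x (1 : R)
            (fun s : R => \int[mu]_(u in `[a, s]) partial_integral c g (u, y) : R)
            (partial_integral c g (x, y)),
        forall y, c < y -> W (x, y) ->
          is_derive y (1 : R) (fun t => partial_integral c g (x, t)) (g (x, y)) &
        {ae mu, forall y : R, c < y -> W (x, y)}]].
Proof.
move=> mg ig.
have [W [mW WP]] := measurable_is_derive_set (measurable_partial_integral c mg) mg.
have : {ae mu, forall x : R, mu.-integrable setT (fun v => (g (x, v))%:E) /\
    (a < x -> forall y, c < y ->
      is_derive x (1 : R)
        (fun s : R => \int[mu]_(u in `[a, s]) partial_integral c g (u, y) : R)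
        (partial_integral c g (x, y)))}.
  by have := ae_is_derive_iterated_integral a c mg ig;
    have := ae_integrable_slice ig; apply: filterS2 => x; split.
move=> [Z [mZ Z0 ZP]]; exists W, Z; split => // x Zx.
have [ix dx] := contrapT (fun H => Zx (ZP x H)).
have cx y : c < y -> {for y, continuous (fun t => partial_integral c g (x, t))}.
  exact: primitive_continuous ix.
split => //.
- by move=> y cy /(WP x c cx y cy).
- have := ae_is_derive_primitive c ix; apply: filterS => y dy cy.
  by apply/(WP x c cx y cy); exact: dy.
Qed.

Lemma integrable_swap g :
  measurable_fun setT g -> (mu \x mu)%E.-integrable setT (EFin \o g) ->
  (mu \x mu)%E.-integrable setT (EFin \o (g \o swap)).
Proof.
move=> mg ig.
have mEg : measurable_fun setT (EFin \o g) by exact/measurable_EFinP.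
apply/integrable12ltyP; last exact: ((integrable21ltyP mu mu mEg).1 ig).
by apply/measurable_EFinP; apply: measurableT_comp => //; exact: measurable_swap.
Qed.

(** Moving both limits of integration into a restriction to a rectangle prepares for Fubini. *)
Lemma integral_partial_integralE g a c s t :
  measurable_fun setT g -> (mu \x mu)%E.-integrable setT (EFin \o g) ->
  (\int[mu]_(u in `[a, s]) (partial_integral c g (u, t))%:E =
   \int[mu]_u \int[mu]_v ((g \_ (`[a, s] `*` `[c, t])) (u, v))%:E)%E.
Proof.
move=> mg ig.
have mg' : measurable_fun setT (g \_ (`[a, s] `*` `[c, t])).
  apply/(measurable_restrictT _ _).1; first exact: measurableX.
  exact: measurable_funTS.
have ig' : (mu \x mu)%E.-integrable setT (EFin \o (g \_ (`[a, s] `*` `[c, t]))).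
  rewrite -restrict_EFin; apply/integrable_restrict => //; first exact: measurableX.
  by rewrite setTI; apply: integrableS ig => //; exact: measurableX.
rewrite integral_mkcond; apply: ae_eq_integral => //.
- apply/(measurable_restrictT _ _).1 => //; apply: measurable_funTS.
  exact: measurable_int (integrable_partial_integral mg ig c t).
- exact: (measurable_fubini_F ig').
have := ae_integrable_slice ig; apply: filterS => u iu _.
rewrite patchE; case: ifPn => uas; last first.
  move: uas; rewrite notin_setE => uas.
  by rewrite integral0_eq// => v _; rewrite patchE memNset// => -[/uas].
rewrite /partial_integral /Rintegral fineK; last first.
  by apply: integrable_fin_num => //; apply: integrableS iu.
rewrite integral_mkcond; apply: eq_integral => v _.
rewrite !patchE; case: ifPn => vct.
  by rewrite mem_set//; split => /=; exact: set_mem.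
by move: vct; rewrite notin_setE => vct; rewrite memNset// => -[_ /vct].
Qed.

(** This identity reduces statements on the second partial derivative to those on the first, for the
    function with exchanged variables. *)
Lemma iterated_integral_swap g a c s t :
  measurable_fun setT g -> (mu \x mu)%E.-integrable setT (EFin \o g) ->
  \int[mu]_(u in `[a, s]) partial_integral c g (u, t) =
  \int[mu]_(v in `[c, t]) partial_integral a (g \o swap) (v, s).
Proof.
move=> mg ig.
have mgs : measurable_fun setT (g \o swap).
  by apply: measurableT_comp => //; exact: measurable_swap.
have E1 := integral_partial_integralE a c s t mg ig.
have E2 := integral_partial_integralE c a t s mgs (integrable_swap mg ig).
have ig' : (mu \x mu)%E.-integrable setT (EFin \o (g \_ (`[a, s] `*` `[c, t]))).
  rewrite -restrict_EFin; apply/integrable_restrict => //; first exact: measurableX.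
  by rewrite setTI; apply: integrableS ig => //; exact: measurableX.
congr fine; apply: (etrans E1); apply: (etrans _ (esym E2)).
apply: (etrans (Fubini ig')); apply: eq_integral => v _.
apply: eq_integral => u _; congr EFin; rewrite !patchE /=.
by congr (if _ then _ else _); apply/idP/idP; rewrite !inE => -[].
Qed.

End mixed_derivative.

(** * Null sets of the plane and their sections *)

Section null_sections.
Context {R : realType}.
Notation mu := (@lebesgue_measure R).
Local Notation swap := (fun p : R * R => (p.2, p.1)).
Implicit Types (A : set (R * R)).

(** The measures of the sections form a nonnegative function with integral zero. *)
Lemma null_product_sections A : measurable A -> (mu \x mu)%E A = 0%E ->
  exists Z : set R, [/\ measurable Z, mu Z = 0%E &
    forall x, ~ Z x -> mu (xsection A x) = 0%E].
Proof.
move=> mA A0.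
have mF : measurable_fun setT (fun x => mu (xsection A x)).
  exact: measurable_fun_xsection.
have : (\int[mu]_x `|mu (xsection A x)| = 0)%E.
  rewrite -[RHS]A0; apply: eq_integral => x _; rewrite gee0_abs//.
move=> /(ae_eq_integral_abs mu measurableT mF).1 [Z [mZ Z0 ZP]].
exists Z; split => // x Zx.
by apply: contrapT => xA; apply/Zx/ZP => /= /(_ I).
Qed.

Lemma null_product_of_sections A (Z : set R) : measurable A ->
  measurable Z -> mu Z = 0%E -> (forall x, ~ Z x -> mu (xsection A x) = 0%E) ->
  (mu \x mu)%E A = 0%E.
Proof.
move=> mA mZ Z0 AZ; rewrite /product_measure1.
rewrite (ae_eq_integral (cst 0%E)) ?integral0//.
  exact: measurable_fun_xsection.
exists Z; split => // x /= /not_implyP[_ xA].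
by apply: contrapT => /AZ.
Qed.

(** Integrating the measures of the horizontal sections defines [mu \x^ mu], which equals [mu \x mu]
    by uniqueness of the product measure. *)
Lemma product_measure_swap A : measurable A ->
  (mu \x mu)%E (swap @^-1` A) = (mu \x mu)%E A.
Proof.
move=> mA; rewrite [RHS](@product_measure_unique _ _ _ _ _ mu mu (mu \x^ mu)%E)//.
by move=> B C mB mC; exact: product_measure2E.
Qed.

Lemma measureD_null (A Z : set R) : measurable A -> measurable Z -> mu Z = 0%E ->
  mu (A `\` Z) = mu A.
Proof.
move=> mA mZ Z0; apply/eqP; rewrite eq_le; apply/andP; split.
  by apply: le_measure; rewrite ?inE//; exact: measurableD.
rewrite -[leRHS]adde0 -Z0; apply: le_trans (measureU2 _ _ _) => //.
- apply: le_measure; rewrite ?inE//; last first.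
    by move=> x Ax; have [Zx|Zx] := pselect (Z x); [right|left].
  by apply: measurableU => //; exact: measurableD.
- exact: measurableD.
Qed.

End null_sections.

(** * Partial and mixed derivatives for one order of the variables *)

Section one_sided.
Context {R : realType}.
Notation mu := (@lebesgue_measure R).

Lemma leb1_measurable_borel (A : set R) : measurable A -> leb1_measurable A.
Proof. exact: sub_caratheodory. Qed.

Lemma leb1_transfer (D N : set R) (f g : R -> R) :
  measurable D -> measurable_fun setT g -> measurable N -> mu N = 0%E ->
  (forall x, D x -> ~ N x -> f x = g x) -> mu.-integrable D (EFin \o g) ->
  leb1.-integrable D (EFin \o f) /\
  \int[leb1]_(x in D) f x = \int[mu]_(x in D) g x.
Proof.
move=> mD mg mN N0 fg ig.
have mid : measurable_fun setT
    (idfun : caratheodory_type ((wlength (@idfun R))^*)%mu -> measurableTypeR R).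
  by move=> _ B mB; rewrite setTI; exact: leb1_measurable_borel.
have m12 (A : set (measurableTypeR R)) :
  measurable A -> mu A = leb1 (idfun @^-1` A) by [].
have mEg : measurable_fun setT (EFin \o g) by exact/measurable_EFinP.
have fg' x : D (idfun x) -> ~ N (idfun x) -> (EFin \o f) x = (EFin \o g) (idfun x).
  by move=> Dx Nx; rewrite /= fg.
have cl := @completed_lebesgue_measure_is_complete R.
split.
- exact: ((complete_integrable cl mid m12 mD mEg mN N0 fg').2 ig).
- congr fine; exact: (complete_integral cl mid m12 mD mEg mN N0 fg' ig).
Qed.

(** Here [f] is any function given by the integral formula on the closed rectangle, so that the
    result applies to the double integral and also to its composite with the swap. *)
Lemma ae_partial_derivatives (a b c d : R) (f g h : R * R -> R) (N : set (R * R)) :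
  measurable_fun setT g -> (mu \x mu)%E.-integrable setT (EFin \o g) ->
  measurable N -> (mu \x mu)%E N = 0%E ->
  (forall p, (`[a, b] `*` `[c, d]) p -> ~ N p -> g p = h p) ->
  (forall s t, s \in `[a, b] -> t \in `[c, d] ->
    f (s, t) = \int[mu]_(u in `[a, s]) partial_integral c g (u, t)) ->
  exists (W : set (R * R)) (Z : set R),
    [/\ measurable W, measurable Z, mu Z = 0%E &
    forall x, x \in `]a, b[ -> ~ Z x ->
    [/\ forall y, y \in `]c, d[ ->
          leb1.-integrable `[c, y] (fun v => (h (x, v))%:E) /\
          has_partial1 f x y (\int[leb1]_(v in `[c, y]) h (x, v)),
        forall y, y \in `]c, d[ -> W (x, y) ->
          has_partial2 (partial1 f) x y (h (x, y)) &
        mu (`]c, d[ `\` xsection W x) = 0%E]].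
Proof.
move=> mg ig mN N0 gh fE.
have [W [Z [mW mZ Z0 WZ]]] := ae_mixed_derivative a c mg ig.
have [ZN [mZN ZN0 NZ]] := null_product_sections mN N0.
(* Removing [N] gives [g = h] at the point itself; discarding [ZN] leaves abscissas with null
   sections of [N], along which [h] integrates like [g]. *)
exists (W `\` N), (Z `|` ZN); split.
- exact: measurableD.
- exact: measurableU.
- apply: measure_negligible; first exact: measurableU.
  by apply: negligibleU; [exists Z|exists ZN]; split.
move=> x xab Zx; have [axx xb] : a < x /\ x < b.
  by move: xab; rewrite in_itv/= => /andP[].
have [ix dx dW aeW] := WZ x (fun H => Zx (or_introl H)).
have {}NZ := NZ x (fun H => Zx (or_intror H)).
have mgx : measurable_fun setT (fun v => g (x, v)) by exact: measurableT_comp.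
have slice y : y \in `]c, d[ ->
    leb1.-integrable `[c, y] (fun v => (h (x, v))%:E) /\
    \int[leb1]_(v in `[c, y]) h (x, v) = partial_integral c g (x, y).
  rewrite in_itv/= => /andP[cy yd].
  apply: (@leb1_transfer `[c, y] (xsection N x) _ (fun v => g (x, v))) => //.
  - exact: measurable_xsection.
  - move=> v /=; rewrite in_itv/= => /andP[cv vy] /xsectionP Nv.
    rewrite gh//=; split; rewrite /= in_itv/= ?(ltW axx) ?(ltW xb)//.
    by rewrite cv (le_trans vy)// ltW.
  - by apply: integrableS ix.
have d1 y : y \in `]c, d[ -> has_partial1 f x y (partial_integral c g (x, y)).
  rewrite in_itv/= => /andP[cy yd].
  apply: near_eq_is_derive (dx axx y cy).
  near=> s; rewrite fE// in_itv/= ?(ltW cy) ?(ltW yd)//.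
  apply/andP; split; apply: ltW.
    by near: s; exact: lt_nbhsr.
  by near: s; exact: lt_nbhsl.
split.
- by move=> y ycd; have [? ->] := slice y ycd; split => //; exact: d1.
- move=> y ycd [Wy Ny]; have /andP[cy yd] := ycd; rewrite -gh//; last first.
    by split; rewrite /= in_itv/= !ltW.
  (* By [d1], [partial1 f] agrees with [partial_integral c g] along the vertical line near [y]. *)
  apply: near_eq_is_derive (dW y cy Wy).
  near=> t; have tcd : t \in `]c, d[.
    rewrite in_itv/=; apply/andP; split.
      by near: t; exact: lt_nbhsr.
    by near: t; exact: lt_nbhsl.
  by have [_ <-] := d1 t tcd.
- have mx : measurable (xsection (W `\` N) x).
    by apply: measurable_xsection; exact: measurableD.
  apply: measure_negligible; first exact: measurableD.
  have nN : mu.-negligible (xsection N x).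
    by exists (xsection N x); split => //; exact: measurable_xsection.
  apply: negligibleS (negligibleU aeW nN).
  move=> y [/= ycd Wy]; have /andP[cy _] : c < y < d by rewrite in_itv in ycd.
  have [Ny|Ny] := pselect (N (x, y)); [right|left].
    exact/xsectionP.
  by move=> /(_ cy) WW; apply/Wy/xsectionP.
Unshelve. all: by end_near. Qed.

End one_sided.

(** * An integrable Borel representative of [h] *)

Section borel_representative.
Context {R : realType}.
Notation mu := (@lebesgue_measure R).
Variables (a b c d : R) (h : R * R -> R).
Hypotheses (ab : a < b) (cd : c < d).
Let Q : set (R * R) := `[a, b] `*` `[c, d].

Let mQ : measurable (Q : set (measurableTypeR R * measurableTypeR R)).
Proof. exact: measurableX. Qed.

Let Qoo : ((mu \x mu) Q < +oo)%E.
Proof.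
rewrite product_measure1E// /= !lebesgue_measure_itv/= !lte_fin ab cd.
by rewrite -EFinM ltry.
Qed.

Lemma leb2_integrable_borel : leb2.-integrable Q (EFin \o h) ->
  exists (g : R * R -> R) (N : set (R * R)),
    [/\ measurable_fun setT g, (mu \x mu)%E.-integrable setT (EFin \o g),
        measurable N, (mu \x mu)%E N = 0%E & forall p, Q p -> ~ N p -> g p = h p].
Proof.
move=> ih.
have mh : measurable_fun (Q : set (caratheodory_type ((mu \x mu)%E^*)%mu)) h.
  exact/measurable_EFinP/(measurable_int _ ih).
have [g [N [mg mN N0 gh g0]]] :=
  @caratheodory_measurable_fun_mod_null _ _ _ (mu \x mu)%E Q h mQ Qoo mh.
exists g, N; split => //.
have mid : measurable_fun setT
    (idfun : caratheodory_type ((mu \x mu)%E^*)%mu ->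
      measurableTypeR R * measurableTypeR R).
  by move=> _ B mB; rewrite setTI; exact: caratheodory_measurable_mu_ext.
have m12 (A : set (measurableTypeR R * measurableTypeR R)) :
    measurable A -> (mu \x mu)%E A = leb2 (idfun @^-1` A).
  by move=> mA; apply/esym/measurable_mu_extE.
have mEg : measurable_fun setT (EFin \o g) by exact/measurable_EFinP.
have hg x : Q (idfun x) -> ~ N (idfun x) -> (EFin \o h) x = (EFin \o g) (idfun x).
  by move=> Qx Nx; rewrite /= gh.
have cl : measure_is_complete (@leb2 R) by exact: measure_is_complete_caratheodory.
have igQ := (complete_integrable cl mid m12 mQ mEg mN N0 hg).1 ih.
(* As [g] vanishes off [Q], integrability on [Q] is integrability on the plane. *)
have -> : g = g \_ Q.
  by apply/funext => p; rewrite patchE; case: ifPn; rewrite // notin_setE => /g0.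
by rewrite -restrict_EFin; apply/integrable_restrict => //; rewrite setTI.
Qed.

End borel_representative.

(** * Construction of [e1], [e2] and [E] *)

Section assembly.
Context {R : realType}.
Notation mu := (@lebesgue_measure R).
Local Notation swap := (fun p : R * R => (p.2, p.1)).

(** Only measure theory is left: [W1] and the swapped [W2] have null complements in the open
    rectangle, the first by vertical sections, the second by horizontal ones. *)
Lemma mixed_derivatives_glue (a b c d : R) (W1 W2 : set (R * R)) (Z1 Z2 : set R) :
  a < b -> c < d -> measurable W1 -> measurable W2 ->
  measurable Z1 -> mu Z1 = 0%E -> measurable Z2 -> mu Z2 = 0%E ->
  (forall x, x \in `]a, b[ -> ~ Z1 x -> mu (`]c, d[ `\` xsection W1 x) = 0%E) ->
  (forall y, y \in `]c, d[ -> ~ Z2 y -> mu (`]a, b[ `\` xsection W2 y) = 0%E) ->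
  exists (e1 e2 : set R) (E : set (R * R)),
    [/\ [/\ measurable e1, e1 `<=` `]a, b[ `\` Z1 & mu e1 = (b - a)%:E],
        [/\ measurable e2, e2 `<=` `]c, d[ `\` Z2 & mu e2 = (d - c)%:E],
        [/\ measurable E, E `<=` e1 `*` e2, E `<=` W1 `&` swap @^-1` W2 &
          (mu \x mu)%E E = ((b - a) * (d - c))%:E],
        forall x, e1 x -> mu (xsection E x) = (d - c)%:E &
        forall y, e2 y -> mu (ysection E y) = (b - a)%:E].
Proof.
move=> ab cd mW1 mW2 mZ1 Z10 mZ2 Z20 WZ1 WZ2.
have sw : measurable_fun setT (swap : R * R -> R * R) by exact: measurable_swap.
have mswap (A : set (R * R)) : measurable A -> measurable (swap @^-1` A).
  by move=> mA; rewrite -[X in measurable X]setTI; exact: sw.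
(* The bounds are general because the claim is used for the rectangle and for its image under the
   swap. *)
have null (x0 x1 y0 y1 : R) (W : set (R * R)) (Z : set R) :
    measurable W -> measurable Z -> mu Z = 0%E ->
    (forall x, x \in `]x0, x1[ -> ~ Z x -> mu (`]y0, y1[ `\` xsection W x) = 0%E) ->
    measurable ((`]x0, x1[ `*` `]y0, y1[) `\` W) /\
    (mu \x mu)%E ((`]x0, x1[ `*` `]y0, y1[) `\` W) = 0%E.
  move=> mW mZ Z0 WZ.
  have mK : measurable ((`]x0, x1[ `*` `]y0, y1[) `\` W).
    by apply: measurableD => //; exact: measurableX.
  split => //; apply: (null_product_of_sections mK mZ Z0) => x Zx.
  have [xI|xI] := boolP (x \in `]x0, x1[).
    rewrite -(WZ x xI Zx); congr (mu _); apply/seteqP; split => y /=.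
      by move=> /xsectionP[[_ yI] Wy]; split => // /xsectionP.
    move=> [yI Wy]; apply/xsectionP; split; first by split.
    by move=> ?; apply/Wy/xsectionP.
  rewrite (_ : xsection _ _ = set0) ?measure0//.
  apply/seteqP; split => // y /xsectionP[[/= xI' _] _].
  by rewrite xI' in xI.
have [mK1 K10] := null _ _ _ _ _ _ mW1 mZ1 Z10 WZ1.
have [mK2 K20] := null _ _ _ _ _ _ mW2 mZ2 Z20 WZ2.
set K1 := _ `\` W1 in mK1 K10; set K2 := _ `\` W2 in mK2 K20.
pose K := K1 `|` swap @^-1` K2.
have mK : measurable K by apply: measurableU => //; exact: mswap.
have K0 : (mu \x mu)%E K = 0%E.
  apply: measure_negligible => //; apply: negligibleU.
    by exists K1; split.
  exists (swap @^-1` K2); split => //; first exact: mswap.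
  exact: etrans (product_measure_swap mK2) K20.
have [Y1 [mY1 Y10 KY1]] := null_product_sections mK K0.
have sK0 : (mu \x mu)%E (swap @^-1` K) = 0%E.
  exact: etrans (product_measure_swap mK) K0.
have [Y2 [mY2 Y20 KY2]] := null_product_sections (mswap _ mK) sK0.
have mZY (X Y : set R) : measurable X -> measurable Y -> measurable (X `|` Y).
  exact: measurableU.
have ZY0 (X Y : set R) : measurable X -> measurable Y -> mu X = 0%E -> mu Y = 0%E ->
    mu (X `|` Y) = 0%E.
  move=> mX mY X0 Y0; apply: measure_negligible; first exact: measurableU.
  by apply: negligibleU; [exists X|exists Y]; split.
have mI (x0 x1 : R) : x0 < x1 -> mu `]x0, x1[ = (x1 - x0)%:E.
  by move=> x01; rewrite lebesgue_measure_itv/= lte_fin x01 -EFinD.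
pose e1 : set R := `]a, b[ `\` (Z1 `|` Y1).
pose e2 : set R := `]c, d[ `\` (Z2 `|` Y2).
have me1 : measurable e1 by apply: measurableD => //; exact: mZY.
have me2 : measurable e2 by apply: measurableD => //; exact: mZY.
have mue1 : mu e1 = (b - a)%:E.
  by rewrite measureD_null ?mI//; [exact: mZY|exact: ZY0].
have mue2 : mu e2 = (d - c)%:E.
  by rewrite measureD_null ?mI//; [exact: mZY|exact: ZY0].
pose E : set (R * R) := (e1 `*` e2) `\` K.
have mE : measurable E by apply: measurableD => //; exact: measurableX.
have Ex x : e1 x -> mu (xsection E x) = (d - c)%:E.
  move=> e1x; rewrite -mue2.
  rewrite -(@measureD_null _ e2 (xsection K x)) //; last 2 first.
  - exact: measurable_xsection.
  - by apply: KY1 => Y1x; case: e1x => _; apply; right.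
  congr (mu _); apply/seteqP; split => y.
    by move=> /xsectionP[[_ e2y] Ky]; split => // /xsectionP.
  move=> [e2y Ky]; apply/xsectionP; split; first by split.
  by move=> ?; apply/Ky/xsectionP.
have Ey y : e2 y -> mu (ysection E y) = (b - a)%:E.
  move=> e2y; rewrite -mue1.
  rewrite -(@measureD_null _ e1 (xsection (swap @^-1` K) y)) //; last 2 first.
  - by apply: measurable_xsection; exact: mswap.
  - by apply: KY2 => Y2y; case: e2y => _; apply; right.
  congr (mu _); apply/seteqP; split => x.
    by move=> /ysectionP[[e1x _] Kx]; split => // /xsectionP.
  move=> [e1x Kx]; apply/ysectionP; split; first by split.
  by move=> ?; apply/Kx/xsectionP.
exists e1, e2, E; split => //.
- by split => // x [xI ZY]; split => // Zx; apply: ZY; left.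
- by split => // x [xI ZY]; split => // Zx; apply: ZY; left.
- split => //.
  + by move=> p [].
  + move=> [x y] [[[/= xI _] [yI _]] Kxy]; split.
      by apply: contrapT => Wxy; apply: Kxy; left.
    by apply: contrapT => Wxy; apply: Kxy; right.
  (* [E] has the measure of the product of [e1] and the interval from [c] to [d]: vertical sections
     of both have measure [d - c] over [e1] and are empty elsewhere. *)
  rewrite EFinM -mue1 -(mI _ _ cd) -product_measure1E//.
  rewrite /= /product_measure1; apply: eq_integral => x _ /=.
  have [e1x|e1x] := pselect (e1 x).
    by rewrite in_xsectionX ?inE// Ex// mI.
  rewrite notin_xsectionX ?notin_setE// (_ : xsection E x = set0)//.
  by apply/seteqP; split => // y /xsectionP[[]].
Qed.

End assembly.

(** * The double integral of [h] in terms of [g], and the theorem *)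

Lemma iterated_integralE (R : realType) (a b c d s t : R) (g h : R * R -> R)
    (N : set (R * R)) :
  let mu := @lebesgue_measure R in
  measurable_fun setT g -> (mu \x mu)%E.-integrable setT (EFin \o g) ->
  measurable N -> (mu \x mu)%E N = 0%E ->
  (forall p, (`[a, b] `*` `[c, d]) p -> ~ N p -> g p = h p) ->
  s \in `[a, b] -> t \in `[c, d] ->
  iterated_integral a c h (s, t) =
  \int[mu]_(u in `[a, s]) partial_integral c g (u, t).
Proof.
move=> mu mg ig mN N0 gh /[!in_itv]/= /andP[as_ sb] /andP[ct td].
have [ZN [mZN ZN0 NZ]] := null_product_sections mN N0.
have [Z [mZ Z0 iZ]] := ae_integrable_slice ig.
rewrite /iterated_integral/=.
have mPt : measurable_fun setT (fun u => partial_integral c g (u, t)).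
  by apply: measurableT_comp (measurable_partial_integral c mg) _.
have iPt : mu.-integrable `[a, s] (EFin \o fun u => partial_integral c g (u, t)).
  by apply: integrableS (integrable_partial_integral mg ig c t).
have mZZ : measurable (Z `|` ZN) by exact: measurableU.
have ZZ0 : mu (Z `|` ZN) = 0%E.
  apply: measure_negligible => //.
  by apply: negligibleU; [exists Z|exists ZN]; split.
(* The inner integrals agree for [u] off a null set; this suffices for the outer integral, whatever
   the inner integral of [h] is at the remaining [u]. *)
have H u : `[a, s]%classic u -> ~ (Z `|` ZN) u ->
    \int[leb1]_(v in `[c, t]) h (u, v) = partial_integral c g (u, t).
  rewrite /= in_itv/= => /andP[au us] Zu.
  have mgu : measurable_fun setT (fun v => g (u, v)) by exact: measurableT_comp.
  have iu : mu.-integrable setT (fun v => (g (u, v))%:E).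
    by apply: contrapT => iu; apply: Zu; left; exact: iZ.
  have Nu0 : mu (xsection N u) = 0%E by apply: NZ => Nu; apply: Zu; right.
  have iut : mu.-integrable `[c, t] (EFin \o (fun v => g (u, v))).
    by apply: integrableS iu.
  apply: (leb1_transfer _ mgu (measurable_xsection _ mN) Nu0 _ iut).2 => //.
  move=> v /=; rewrite in_itv/= => /andP[cv vt] Nv.
  rewrite gh//; last by move=> Nuv; apply/Nv/xsectionP.
  by split; rewrite /= in_itv/= ?au ?cv (le_trans _ sb, le_trans _ td).
exact: (leb1_transfer _ mPt mZZ ZZ0 H iPt).2.
Qed.

Theorem theorem6 (R : realType) (a b c d : R) (h : R * R -> R)
    (ab : a < b) (cd : c < d)
    (hint : leb2.-integrable (`[a, b] `*` `[c, d]) (EFin \o h)) :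
  let f := iterated_integral a c h in
  exists e1 e2 : set R,
    [/\ [/\ leb1_measurable e1, e1 `<=` `]a, b[ & leb1 e1 = (b - a)%:E],
        [/\ leb1_measurable e2, e2 `<=` `]c, d[ & leb1 e2 = (d - c)%:E],
        (forall x y : R, e1 x -> y \in `]c, d[ ->
           leb1.-integrable `[c, y] (fun v => (h (x, v))%:E) /\
           has_partial1 f x y (\int[leb1]_(v in `[c, y]) h (x, v))),
        (forall x y : R, x \in `]a, b[ -> e2 y ->
           leb1.-integrable `[a, x] (fun u => (h (u, y))%:E) /\
           has_partial2 f x y (\int[leb1]_(u in `[a, x]) h (u, y))) &
        exists E : set (R * R),
          [/\ [/\ leb2_measurable E, E `<=` e1 `*` e2 &
                  leb2 E = ((b - a) * (d - c))%:E],
              (forall x y : R, E (x, y) ->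
                 has_partial2 (partial1 f) x y (h (x, y)) /\
                 has_partial1 (partial2 f) x y (h (x, y))),
              (forall x : R, e1 x ->
                 let Ex := [set y : R | `]c, d[%classic y /\ E (x, y)] in
                 leb1_measurable Ex /\ leb1 Ex = (d - c)%:E) &
              (forall y : R, e2 y ->
                 let Ey := [set x : R | `]a, b[%classic x /\ E (x, y)] in
                 leb1_measurable Ey /\ leb1 Ey = (b - a)%:E)]].
Proof.
move=> f.
have [g [N [mg ig mN N0 gh]]] := leb2_integrable_borel ab cd hint.
pose swap (p : R * R) := (p.2, p.1).
have msw : measurable_fun setT swap by exact: measurable_swap.
have mgs : measurable_fun setT (g \o swap) by exact: measurableT_comp.
have igs := integrable_swap mg ig.
have mNs : measurable (swap @^-1` N).
  by rewrite -[X in measurable X]setTI; exact: msw.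
have Ns0 := etrans (product_measure_swap mN) N0.
have fE s t : s \in `[a, b] -> t \in `[c, d] -> f (s, t) =
    \int[lebesgue_measure]_(u in `[a, s]) partial_integral c g (u, t).
  exact: iterated_integralE mg ig mN N0 gh.
(* By Fubini, [f \o swap] is the double integral of [g \o swap], so the one-sided result also
   applies with the variables exchanged. *)
have fsE t s : t \in `[c, d] -> s \in `[a, b] -> (f \o swap) (t, s) =
    \int[lebesgue_measure]_(v in `[c, t]) partial_integral a (g \o swap) (v, s).
  by move=> tcd sab; rewrite /= fE//; exact: iterated_integral_swap.
have ghs p : (`[c, d] `*` `[a, b]) p -> ~ (swap @^-1` N) p ->
    (g \o swap) p = (h \o swap) p.
  by move=> [? ?] ?; apply: gh.
have [W1 [Z1 [mW1 mZ1 Z10 P1]]] := ae_partial_derivatives mg ig mN N0 gh fE.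
have [W2 [Z2 [mW2 mZ2 Z20 P2]]] := ae_partial_derivatives mgs igs mNs Ns0 ghs fsE.
have WZ1 x : x \in `]a, b[ -> ~ Z1 x ->
    lebesgue_measure (`]c, d[ `\` xsection W1 x) = 0%E.
  by move=> xab Zx; have [] := P1 x xab Zx.
have WZ2 y : y \in `]c, d[ -> ~ Z2 y ->
    lebesgue_measure (`]a, b[ `\` xsection W2 y) = 0%E.
  by move=> ycd Zy; have [] := P2 y ycd Zy.
have [e1 [e2 [E [[me1 e1Z mue1] [me2 e2Z mue2] [mE Ee EW muE] Ex Ey]]]] :=
  mixed_derivatives_glue ab cd mW1 mW2 mZ1 Z10 mZ2 Z20 WZ1 WZ2.
exists e1, e2; split.
- by split; [exact: leb1_measurable_borel|move=> x /e1Z[]|].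
- by split; [exact: leb1_measurable_borel|move=> x /e2Z[]|].
- by move=> x y /e1Z[xab Zx] ycd; have [+ _ _] := P1 x xab Zx; exact.
- by move=> x y xab /e2Z[ycd Zy]; have [+ _ _] := P2 y ycd Zy; exact.
exists E; split.
- split => //; first exact: caratheodory_measurable_mu_ext.
  by rewrite -muE; exact: measurable_mu_extE.
- move=> x y Exy; have [/= /e1Z[xab Zx] /e2Z[ycd Zy]] := Ee _ Exy.
  have [W1xy W2yx] := EW _ Exy; split.
    by have [_ + _] := P1 x xab Zx; exact.
  (* By computation, [partial1] of [f \o swap] is [partial2 f] at the swapped point. *)
  by have [_ + _] := P2 y ycd Zy; exact.
- move=> x e1x Ex'.
  have -> : Ex' = xsection E x.
    apply/seteqP; split => y; first by move=> [_ ?]; exact/xsectionP.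
    by move=> /xsectionP Exy; split => //; have [_ /e2Z[]] := Ee _ Exy.
  by split; [apply: leb1_measurable_borel; exact: measurable_xsection|exact: Ex].
- move=> y e2y Ey'.
  have -> : Ey' = ysection E y.
    apply/seteqP; split => x; first by move=> [_ ?]; exact/ysectionP.
    by move=> /ysectionP Exy; split => //; have [/e1Z[]] := Ee _ Exy.
  by split; [apply: leb1_measurable_borel; exact: measurable_ysection|exact: Ey].
Qed.
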